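(* Let $i \geq 7$. The Fibonacci word $F_i$ has exactly three net occurrences, namely: the occurrence of $F_{i-2}$ starting at position $f_{i-1}+1$, and the two occurrences of $F_{i-2}\,Q_i$ starting at positions $1$ and $f_{i-2}+1$.
   Context: Strings are over the alphabet $\{\texttt{a},\texttt{b}\}$; positions are 1-indexed and $T[i\ldots j]$ denotes the substring from position $i$ to position $j$. Fibonacci words: $F_1=\texttt{b}$, $F_2=\texttt{a}$, $F_k=F_{k-1}F_{k-2}$ for $k\ge 3$; $f_k=|F_k|$. For $i\ge 7$, $Q_i := F_{i-5}F_{i-6}\cdots F_3F_2$ (concatenation in decreasing order of index). In a text $T$ of length $n$, an occurrence is a pair $(i,j)$ with $1\le i\le j\le n$; it is an occurrence of $S$ if $T[i\ldots j]=S$, and ''$S$ occurs at position $i$'' means $T[i\ldots i+|S|-1]=S$. A string is unique in $T$ if it occurs exactly once and repeated if it occurs at least twice. An occurrence $(i,j)$ is a net occurrence if $T[i\ldots j]$ is repeated while both $T[i-1\ldots j]$ and $T[i\ldots j+1]$ are unique; by convention $T[i-1\ldots j]$ is considered unique when $i=1$ and $T[i\ldots j+1]$ is considered unique when $j=n$. *)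

(* Defs.v *)
From HB Require Import structures.
From mathcomp Require Import all_boot.

Set Implicit Arguments.
Unset Strict Implicit.
Unset Printing Implicit Defensive.

Inductive letter : Type := La | Lb.

Definition letter_to_bool (x : letter) : bool := if x is Lb then true else false.
Definition bool_to_letter (x : bool) : letter := if x then Lb else La.
Lemma letter_to_boolK : cancel letter_to_bool bool_to_letter.
Proof. by case. Qed.
HB.instance Definition _ := Equality.copy letter (can_type letter_to_boolK).

(* All positions in strings below are 1-indexed and ranges are inclusive. *)

Section Occurrences.
Variable A : eqType.
Implicit Types (T S : seq A) (i j p : nat).

Definition is_occ T i j : bool := [&& 1 <= i, i <= j & j <= size T].

(* T[i .. j]; only meaningful when is_occ T i j holds. *)
Definition substr T i j : seq A := drop i.-1 (take j T).

Definition occ_of T S i j : bool := is_occ T i j && (substr T i j == S).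

Definition occ_from S p : nat * nat := (p, (p + size S).-1).

Definition occurs_at T S p : bool := occ_of T S (occ_from S p).1 (occ_from S p).2.

Definition num_occ T S : nat := count (occurs_at T S) (iota 1 (size T)).

Definition unique T S : bool := num_occ T S == 1.
Definition repeated T S : bool := 2 <= num_occ T S.

Definition net_occ T i j : bool :=
  [&& is_occ T i j,
      repeated T (substr T i j),
      (i == 1) || unique T (substr T i.-1 j)
    & (j == size T) || unique T (substr T i j.+1)].

End Occurrences.

(* Indexing starts at 1; the value at 0 is a dummy. *)
Fixpoint fibw (k : nat) : seq letter :=
  match k with
  | 0 => [::]
  | 1 => [:: Lb]
  | k1.+1 =>
    match k1 with
    | k2.+1 => if k2 is 0 then [:: La] else fibw k1 ++ fibw k2
    | 0 => [::]
    end
  end.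

Definition fibl (k : nat) : nat := size (fibw k).

(* The word F_(i-5) F_(i-6) ... F_3 F_2 for 7 <= i (a single factor F_2 when i = 7). *)
Definition Qw (i : nat) : seq letter :=
  flatten [seq fibw k | k <- rev (iota 2 (i - 6))].

(* Main.v *)
Require Import Defs.
From mathcomp Require Import all_boot zify.

(** Net occurrences are the inclusion-maximal repeated occurrences. An occurrence
    contained in none of the three listed ones must contain one of the windows
    [f_(i-2), f_(i-1) - 1] and [f_(i-1), f_i - 1], so it suffices that these
    windows carry unique strings. Both are instances of one fact: among all
    windows of length f_n in F_(n+3), the one at position f_(n+1) (the singular
    word of order n) is the only one whose number of b's differs from that of F_n.
    Indeed F_(n+2) minus its last two letters, and the suffix F_n F_n F_(n-1) of
    F_(n+3), both have period f_n, while the singular word is F_n with its last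
    letter removed and the other letter prepended. *)

(** * Net occurrences as maximal repeated occurrences *)

Section NetOccurrences.
Local Set Implicit Arguments.
Local Unset Strict Implicit.
Variable A : eqType.
Implicit Types (T S : seq A).

Definition repeated_occ T s e := is_occ T s e && repeated T (substr T s e).

Lemma size_substr T s e : is_occ T s e -> size (substr T s e) = e - s.-1.
Proof.
case/and3P=> s0 se eT.
by rewrite size_drop size_takel.
Qed.

Lemma substrE T s e : substr T s e = take (e - s.-1) (drop s.-1 T).
Proof.
rewrite /substr take_drop.
have [le|/ltnW lt] := leqP s.-1 e; first by rewrite subnK.
rewrite (eqP lt) add0n !drop_oversize //; rewrite size_take; case: ifP; lia.
Qed.

Lemma occurs_atE T S p : 0 < size S ->
  occurs_at T S p =
  [&& 0 < p, p.-1 + size S <= size T & take (size S) (drop p.-1 T) == S].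
Proof.
move=> S0; rewrite /occurs_at /occ_of /is_occ substrE /=.
case: p => [|p] //=.
by rewrite addKn; have -> : p < p + size S by lia.
Qed.

Lemma occurs_at_substr T s e p : is_occ T s e ->
  occurs_at T (substr T s e) p =
  [&& 0 < p, p.-1 + (e - s.-1) <= size T &
     take (e - s.-1) (drop p.-1 T) == take (e - s.-1) (drop s.-1 T)].
Proof.
move=> ose; rewrite occurs_atE size_substr ?substrE //.
by case/and3P: ose => *; lia.
Qed.

Lemma occurs_at_iota T S p : 0 < size S -> occurs_at T S p -> p \in iota 1 (size T).
Proof. by move=> S0; rewrite occurs_atE // mem_iota => /and3P[? ? _]; lia. Qed.

Lemma repeated_occP T s e :
  reflect (is_occ T s e /\ exists2 p, p != s & occurs_at T (substr T s e) p)
          (repeated_occ T s e).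
Proof.
apply: (iffP andP) => -[ose]; set S := substr T s e.
all: have S0 : 0 < size S by rewrite size_substr //; case/and3P: ose => *; lia.
all: have Ss : occurs_at T S s
  by rewrite occurs_at_substr // eqxx andbT; case/and3P: ose => *; lia.
all: have : perm_eq (iota 1 (size T)) (s :: rem s (iota 1 (size T)))
  by apply: perm_to_rem; apply: occurs_at_iota Ss.
all: rewrite /repeated /num_occ => /permP -> /=; rewrite Ss ltnS -has_count.
  case/hasP=> p; rewrite mem_rem_uniq ?iota_uniq // => /andP[/= ps _] Sp.
  by split=> //; exists p.
case=> p ps Sp; split=> //; apply/hasP; exists p => //.
by rewrite mem_rem_uniq ?iota_uniq // inE ps (occurs_at_iota S0 Sp).
Qed.

Lemma unique_substr T s e : is_occ T s e ->
  unique T (substr T s e) = ~~ repeated_occ T s e.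
Proof.
move=> ose; rewrite /unique /repeated_occ ose /repeated -leqNgt.
suff : 0 < num_occ T (substr T s e) by lia.
rewrite /num_occ -has_count.
have Ss : occurs_at T (substr T s e) s
  by rewrite occurs_at_substr // eqxx andbT; case/and3P: ose => *; lia.
apply/hasP; exists s => //; apply: (occurs_at_iota _ Ss).
by rewrite size_substr //; case/and3P: ose => *; lia.
Qed.

Lemma repeated_occ_sub T s e s' e' :
  repeated_occ T s e -> s <= s' -> s' <= e' -> e' <= e -> repeated_occ T s' e'.
Proof.
case/repeated_occP=> ose [p ps Sp] ss se ee; apply/repeated_occP.
have ose' : is_occ T s' e' by move: ose; rewrite /is_occ; lia.
split=> //; exists (p + (s' - s)); first by lia.
move: Sp; rewrite !occurs_at_substr //.
case/and3P=> p0 pT /eqP E; move: (ose); rewrite /is_occ => /and3P[s0 _ eT].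
apply/and3P; split; [lia|lia|].
have -> : (p + (s' - s)).-1 = (s' - s) + p.-1 by lia.
have -> : s'.-1 = (s' - s) + s.-1 by lia.
rewrite -!drop_drop !(take_drop _ (s' - s)).
(* Since [e' <= e], the minimum is its first argument; this form lets [take_min] expose the two
   sides of [E]. *)
have -> : e' - (s' - s + s.-1) + (s' - s) = minn (e' - s.-1) (e - s.-1) by lia.
by rewrite !take_min E.
Qed.

Lemma net_occE T s e :
  net_occ T s e = [&& repeated_occ T s e, (s == 1) || ~~ repeated_occ T s.-1 e
                    & (e == size T) || ~~ repeated_occ T s e.+1].
Proof.
rewrite /net_occ {1}/repeated_occ -andbA.
case ose: (is_occ T s e) => //=; congr [&& _ , _ & _].
  by case: eqVneq => //= s1; rewrite unique_substr //; move: ose; rewrite /is_occ; lia.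
by case: eqVneq => //= s1; rewrite unique_substr //; move: ose; rewrite /is_occ; lia.
Qed.

(** By [repeated_occ_sub], repetition passes to sub-occurrences, so one-letter extensions suffice to
    test maximality. A repeated extension of a member of [L] would be covered by another member,
    against the antichain condition. *)
Lemma net_occ_maximal T (L : seq (nat * nat)) :
    (forall o, o \in L -> repeated_occ T o.1 o.2) ->
    (forall s e, repeated_occ T s e ->
       exists2 o, o \in L & (o.1 <= s) && (e <= o.2)) ->
    {in L &, forall o o', o'.1 <= o.1 -> o.2 <= o'.2 -> o = o'} ->
  forall s e, net_occ T s e <-> (s, e) \in L.
Proof.
move=> repL coverL antiL s e; rewrite net_occE; split.
  case/and3P=> rep_se maxl maxr.
  have [[a b] abL /= /andP[as_ eb]] := coverL _ _ rep_se.
  have rep_ab := repL _ abL; have := rep_ab => /andP[/and3P[/= a0 ab bT] _].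
  have /andP[/and3P[s0 se eT] _] := rep_se.
  suff [-> ->] : s = a /\ e = b by [].
  split.
    case/orP: maxl => [/eqP|]; first by lia.
    apply: contraNeq => sa; apply: repeated_occ_sub rep_ab _ _ _ => /=; lia.
  case/orP: maxr => [/eqP|]; first by lia.
  apply: contraNeq => sa; apply: repeated_occ_sub rep_ab _ _ _ => /=; lia.
move=> seL; have rep_se := repL _ seL; rewrite rep_se /=.
apply/andP; split; apply/orP.
  have [s1|s1] := eqVneq s 1; [by left | right; apply/negP => rep].
  have [[a b] abL /= /andP[as_ eb]] := coverL _ _ rep.
  have /andP[/and3P[s0 _ _] _] := rep.
  have [] : (s, e) = (a, b) by apply: antiL => //=; lia.
  lia.
have [s1|s1] := eqVneq e (size T); [by left | right; apply/negP => rep].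
have [[a b] abL /= /andP[as_ eb]] := coverL _ _ rep.
have [] : (s, e) = (a, b) by apply: antiL => //=; lia.
  lia.
Qed.

End NetOccurrences.

(** * Fibonacci words and their central prefixes *)

Lemma fibwS k : fibw k.+3 = fibw k.+2 ++ fibw k.+1.
Proof. by []. Qed.

Local Arguments fibw : simpl never.

Lemma fiblS k : fibl k.+3 = fibl k.+2 + fibl k.+1.
Proof. by rewrite /fibl fibwS size_cat. Qed.

Lemma fibl_gt0 k : 0 < fibl k.+1.
Proof. by elim: k => // -[|k] // IH; rewrite fiblS; lia. Qed.

(* [central k] is F_(k+3) without its last two letters, and [Qw i] is [central (i - 6)]. *)
Definition central k : seq letter := flatten [seq fibw j | j <- rev (iota 2 k)].

Definition fib_tail k : seq letter := if odd k then [:: Lb; La] else [:: La; Lb].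

Lemma centralS k : central k.+1 = fibw k.+2 ++ central k.
Proof. by rewrite /central -{1}[k.+1]addn1 iotaD rev_cat map_cat flatten_cat /= cats0. Qed.

Lemma centralSS k : central k.+2 = fibw k.+4 ++ central k.
Proof. by rewrite !centralS catA. Qed.

Lemma fibw_central k : fibw k.+3 = central k ++ fib_tail k.
Proof.
suff: fibw k.+3 = central k ++ fib_tail k /\
  fibw k.+4 = central k.+1 ++ fib_tail k.+1 by case.
elim: k => [//|k [IH1 IH2]]; split=> //.
by rewrite fibwS IH1 centralSS -catA /fib_tail /= negbK.
Qed.

Lemma size_central k : size (central k) = fibl k.+3 - 2.
Proof.
rewrite /fibl fibw_central size_cat /fib_tail.
by case: odd; rewrite addnK.
Qed.

(** Both are prefixes of F_(k+4). With [centralS] this gives [central k.+1] the period f_(k+2). *)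
Lemma prefix_central k : prefix (central k) (central k.+1).
Proof.
have E : central k.+1 ++ fib_tail k.+1 = central k ++ (fib_tail k ++ fibw k.+2).
  by rewrite -fibw_central fibwS fibw_central catA.
have le : size (central k) <= size (central k.+1).
  by rewrite centralS size_cat leq_addl.
by rewrite prefixE -[X in take _ X](take_size_cat (fib_tail k.+1) erefl) -take_min
  E (minn_idPl le) take_size_cat.
Qed.

(** * Counting b's in windows *)

Section Windows.
Local Set Implicit Arguments.
Local Unset Strict Implicit.
Variable A : eqType.
Implicit Types (u v : seq A).

Lemma take_drop_cat n t u v :
  t + n <= size u -> take n (drop t (u ++ v)) = take n (drop t u).
Proof.
by move=> le; rewrite !take_drop addnC takel_cat.
Qed.

Lemma count_take_add (a : pred A) n t u :
  count a (take (t + n) u) = count a (take t u) + count a (take n (drop t u)).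
Proof. by rewrite takeD count_cat. Qed.

(** The prefix condition says that [u ++ v] has period [size u]. Its first [t + size u] letters
    split as [take t v] and the window, or as [u] and [take t v]; cancel. *)
Lemma count_window_periodic (a : pred A) u v t :
    prefix v (u ++ v) -> t <= size v ->
  count a (take (size u) (drop t (u ++ v))) = count a u.
Proof.
move=> /prefixP[z E] tv; have := count_take_add a (size u) t (u ++ v).
by rewrite {2}E (takel_cat _ tv) addnC takeD take_size_cat // drop_size_cat //
  count_cat addnC => /addnI.
Qed.

End Windows.

Lemma count_fibw_window k t : 0 < k ->
    t + fibl k.+2 <= fibl k.+4.+1 -> t.+1 != fibl k.+3 ->
  count_mem Lb (take (fibl k.+2) (drop t (fibw k.+4.+1))) = count_mem Lb (fibw k.+2).
Proof.
case: k => // k _ tle tne.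
have := fiblS k.+1; have := fiblS k.+2; have := fiblS k.+3; have := fibl_gt0 k => l1 l5 l4 l3.
(* Now n = k+3 and [t] is 0-based. From f_(n+1) on, the window lies in the suffix F_n F_(n+1).
   Otherwise [tne] leaves t <= f_(n+1) - 2, so the window ends before the last two letters of
   F_(n+2). *)
have [tr | rt] := leqP (fibl k.+4) t.
  rewrite (fibwS k.+3) (fibwS k.+2) -catA drop_cat -/(fibl k.+4) ltnNge tr /=.
  apply: count_window_periodic; last by rewrite -/(fibl k.+4); lia.
  by rewrite (fibwS k.+1) prefix_catr // eqxx (fibwS k) -catA prefix_prefix.
have sc := size_central k.+1.
have -> : fibw k.+2.+4 =
    (fibw k.+3 ++ central k.+1) ++ (fib_tail k.+2 ++ fibw k.+4).
  by rewrite (fibwS k.+3) (fibw_central k.+2) centralS -catA.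
rewrite take_drop_cat.
  apply: count_window_periodic; last by rewrite sc; lia.
  by rewrite -centralS prefix_central.
by rewrite size_cat -/(fibl k.+3) sc; lia.
Qed.

(** The window is what remains of F_(k+4) without its last letter after removing F_(k+3) without its
    last letter. By [centralS] its count differs from that of F_(k+2) by the first letters of two
    consecutive [fib_tail]s, which are distinct. *)
Lemma count_fibw_singular k :
  count_mem Lb (take (fibl k.+2) (drop (fibl k.+3).-1 (fibw k.+4.+1)))
  != count_mem Lb (fibw k.+2).
Proof.
have := count_take_add (pred1 Lb) (fibl k.+2) (fibl k.+3).-1 (fibw k.+4.+1).
have E j : take (fibl j.+3).-1 (fibw j.+3) = central j ++ take 1 (fib_tail j).
  have s2 : size (fib_tail j) = 2 by rewrite /fib_tail; case: odd.
  have -> : (fibl j.+3).-1 = (size (central j) + 1).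
    by rewrite /fibl fibw_central size_cat s2; lia.
  by rewrite fibw_central takeD take_size_cat // drop_size_cat.
have -> : (fibl k.+3).-1 + fibl k.+2 = (fibl k.+4).-1.
  by have := fiblS k.+1; have := fibl_gt0 k.+2; lia.
have le3 : (fibl k.+3).-1 <= size (fibw k.+3) by rewrite -/(fibl _); lia.
have le4 : (fibl k.+4).-1 <= size (fibw k.+4) by rewrite -/(fibl _); lia.
rewrite [fibw k.+4.+1]fibwS (takel_cat _ le4) E [fibw k.+4]fibwS -catA (takel_cat _ le3) E.
rewrite centralS !count_cat.
by rewrite /fib_tail /=; case: odd => /=; lia.
Qed.

(** Allowing a prefix [T] lets F_i be treated both as F_(n+3) and as a prefix of F_(n+3) with n =
    i-2. *)
Lemma singular_occ_once k T : 0 < k -> prefix T (fibw k.+4.+1) ->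
  ~~ repeated_occ T (fibl k.+3) (fibl k.+4).-1.
Proof.
move=> k0 /prefixP[Z E]; apply/negP => /repeated_occP[ose [p pr]].
rewrite occurs_at_substr //.
have := fibl_gt0 k.+2; have := fibl_gt0 k.+1; have := fiblS k.+1 => l4 l2 l3.
have -> : (fibl k.+4).-1 - (fibl k.+3).-1 = fibl k.+2 by lia.
case/and3P=> p0 pT /eqP U.
have /and3P[_ _ eT] := ose.
have := count_fibw_singular k.
rewrite E take_drop_cat; last by lia.
rewrite -U -(take_drop_cat Z) // -E count_fibw_window ?eqxx //; last by lia.
by rewrite {2}/fibl E size_cat (leq_trans pT) ?leq_addr.
Qed.

(** * The three occurrences in F_i *)

Lemma repeated_occ_from {A : eqType} {T S : seq A} {p q} :
    0 < size S -> p != q -> occurs_at T S p -> occurs_at T S q ->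
  repeated_occ T (occ_from S p).1 (occ_from S p).2.
Proof.
move=> S0 pq Sp Sq; have /andP[op /eqP E] := Sp.
by apply/repeated_occP; rewrite E; split=> //; exists q; rewrite // eq_sym.
Qed.

Lemma occurs_at_cat {A : eqType} (u S v : seq A) :
  0 < size S -> occurs_at (u ++ S ++ v) S (size u + 1).
Proof.
move=> S0; rewrite occurs_atE // addn1 /= !size_cat drop_size_cat // take_size_cat //.
by rewrite eqxx andbT leq_add2l leq_addr.
Qed.

Theorem theorem33 (i : nat) (hi : 7 <= i) :
  let o1 := occ_from (fibw (i - 2)) (fibl (i - 1) + 1) in
  let o2 := occ_from (fibw (i - 2) ++ Qw i) 1 in
  let o3 := occ_from (fibw (i - 2) ++ Qw i) (fibl (i - 2) + 1) in
  [/\ occurs_at (fibw i) (fibw (i - 2)) (fibl (i - 1) + 1),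
      occurs_at (fibw i) (fibw (i - 2) ++ Qw i) 1
    & occurs_at (fibw i) (fibw (i - 2) ++ Qw i) (fibl (i - 2) + 1)] /\
  uniq [:: o1; o2; o3] /\
  (forall s e : nat, net_occ (fibw i) s e <-> (s, e) \in [:: o1; o2; o3]).
Proof.
case: i hi => [|[|[|[|[|[|[|m]]]]]]] // _.
have -> : Qw m.+4.+3 = central m.+1.
  by rewrite /Qw /central; congr (flatten (map _ (rev (iota _ _)))); lia.
(* F_(i-2) Q_i is F_(i-1) without its last two letters. *)
rewrite !subSS !subn0 -centralSS.
set T := fibw m.+4.+3; set P := central m.+3; set F := fibw m.+4.+1.
move=> o1 o2 o3.
have l7 := fiblS m.+4; have l6 := fiblS m.+3; have l5 := fiblS m.+2; have l4 := fiblS m.+1.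
have l3 := fibl_gt0 m.+2; have l2 := fibl_gt0 m.+1.
have sF : size F = fibl m.+4.+1 by [].
have sT : size T = fibl m.+4.+3 by [].
have sP : size P = fibl m.+4.+2 - 2 by rewrite /P size_central.
have F0 : 0 < size F by rewrite sF; lia.
have P0 : 0 < size P by rewrite sP; lia.
have occ1 : occurs_at T F (fibl m.+4.+2 + 1).
  by have := occurs_at_cat (fibw m.+4.+2) F [::] F0; rewrite cats0.
(* This occurrence only witnesses that [o1] is repeated; it lies inside [o2]. *)
have occ1' : occurs_at T F 1.
  have := occurs_at_cat [::] F (fibw m.+4 ++ F) F0.
  by rewrite cat0s catA.
have occ2 : occurs_at T P 1.
  have := occurs_at_cat [::] P (fib_tail m.+3 ++ F) P0.
  by rewrite cat0s catA -fibw_central.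
have occ3 : occurs_at T P (fibl m.+4.+1 + 1).
  have := occurs_at_cat F P (fib_tail m.+4) P0.
  by rewrite catA -centralS -fibw_central.
split=> //.
have E1 : o1 = (fibl m.+4.+2 + 1, fibl m.+4.+3).
  by rewrite /o1 /occ_from sF; congr pair; lia.
have E2 : o2 = (1, fibl m.+4.+2 - 2).
  by rewrite /o2 /occ_from sP; congr pair; lia.
have E3 : o3 = (fibl m.+4.+1 + 1, fibl m.+4.+3 - 2).
  by rewrite /o3 /occ_from sP; congr pair; lia.
split.
  by rewrite E1 E2 E3 /= !inE !xpair_eqE; lia.
have U1 : ~~ repeated_occ T (fibl m.+4.+1) (fibl m.+4.+2).-1.
  by apply: (singular_occ_once m.+2) => //; apply: prefix_refl.
have U2 : ~~ repeated_occ T (fibl m.+4.+2) (fibl m.+4.+3).-1.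
  apply: (singular_occ_once m.+3) => //.
  by rewrite (fibwS m.+4.+1) prefix_prefix.
apply: net_occ_maximal.
- move=> o; rewrite !inE => /or3P[] /eqP->.
  + by apply: (repeated_occ_from _ _ occ1 occ1') => //; lia.
  + by apply: (repeated_occ_from _ _ occ2 occ3) => //; lia.
  + by apply: (repeated_occ_from _ _ occ3 occ2) => //; lia.
- move=> s e rep.
  have /andP[/and3P[s0 se eT] _] := rep; rewrite sT in eT.
  (* A repeated occurrence contains neither singular window. Beyond f_(i-1), [s] puts it in [o1];
     beyond f_(i-2) only, [N2] bounds [e] and gives [o3]; otherwise [N1] gives [o2]. *)
  have N1 : (fibl m.+4.+1 < s) || (e < (fibl m.+4.+2).-1).
    apply: contraNT U1; rewrite negb_or -!leqNgt => /andP[h1 h2].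
    by apply: repeated_occ_sub rep _ _ _ => //; lia.
  have N2 : (fibl m.+4.+2 < s) || (e < (fibl m.+4.+3).-1).
    apply: contraNT U2; rewrite negb_or -!leqNgt => /andP[h1 h2].
    by apply: repeated_occ_sub rep _ _ _ => //; lia.
  have [h1|h1] := ltnP (fibl m.+4.+2) s.
    by exists o1; rewrite ?inE ?eqxx // E1 /=; lia.
  have [h2|h2] := ltnP (fibl m.+4.+1) s.
    by exists o3; rewrite ?inE ?eqxx ?orbT // E3 /=; lia.
  by exists o2; rewrite ?inE ?eqxx ?orbT // E2 /=; lia.
(* Starts and ends both increase strictly from [o2] to [o3] to [o1]. *)
- move=> o o'; rewrite !inE E1 E2 E3.
  by case/or3P=> /eqP-> /or3P[] /eqP-> //=; lia.
Qed.
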